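(* For every $n\in\mathbb N$ and every measurable partition of unity $D$ on $X$, the function $\mu\mapsto\tau_n(\mu,D)$ is concave on $M(X,m)$; and the function $\mu\mapsto\tau(\mu)$ is concave on $M(X,m)$.
   Context: Setting: $(X,\mathfrak A)$ is a measurable space with a $\sigma$-finite measure $m$, and $\alpha:X\to X$ is a measurable mapping. The shift operator $Af=f\circ\alpha$ is assumed to be bounded on the real space $L^1(X,m)$; equivalently there is a constant $C$ with $m(\alpha^{-1}(G))\le C\,m(G)$ for all $G\in\mathfrak A$. $L^\infty(X,m)$ is the space of essentially bounded real-valued functions. $M(X,m)$ is the set of all positive normalized linear functionals $\mu$ on $L^\infty(X,m)$ (positive: $\mu(f)\ge0$ for $f\ge0$; normalized: $\mu(1)=1$); it is a convex set. A measurable partition of unity on $X$ is a finite set $D=\{g_1,\dots,g_k\}$ of nonnegative functions $g_i\in L^\infty(X,m)$ with $g_1+\dots+g_k\equiv1$ almost everywhere. $t$-entropy: for $\mu\in M(X,m)$, $$\tau(\mu)=\inf_{n\in\mathbb N}\frac{\tau_n(\mu)}n,\qquad \tau_n(\mu)=\inf_D\tau_n(\mu,D),\qquad \tau_n(\mu,D)=\sup_{\|f\|=1}\sum_{g\in D}\mu(g)\ln\frac{\int_X g\,|f\circ\alpha^n|\,dm}{\mu(g)},$$ where the infimum is over all measurable partitions of unity $D$ on $X$ and the supremum over all $f\in L^1(X,m)$ with $\|f\|=1$. If $\mu(g)=0$ the corresponding summand is taken to be $0$ regardless of the integral; if some $g\in D$ has $\int_X g\,dm=0$ and $\mu(g)>0$,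 then $\tau(\mu)=-\infty$. Values lie in $[-\infty,\infty)$, with $\ln0=-\infty$. *)

(* Defs.v *)
From HB Require Import structures.
From mathcomp Require Import all_boot all_order all_algebra.
From mathcomp Require Import all_classical all_reals all_analysis.

Set Implicit Arguments.
Unset Strict Implicit.
Unset Printing Implicit Defensive.

Import Order.TTheory GRing.Theory Num.Theory.
Import numFieldNormedType.Exports.

Local Open Scope classical_set_scope.
Local Open Scope ring_scope.

(* Elements are measurable functions, not a.e.-classes; conditions on them are
   therefore imposed almost everywhere below. *)
Notation L1fun m := (LfunType m (@lexx _ _ 1%E)).
Notation Linfun m := (LfunType m (leey 1%E)).

(* Concavity on A of a function with values in [-oo, +oo).  Excluding +oo keeps
   the library convention -oo + +oo = -oo out of play; for t = 0 or t = 1 the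
   inequality is trivial because 0 * -oo = 0. *)
Definition concave_on (R : realType) (E : lmodType R) (A : set E)
    (F : E -> \bar R) : Prop :=
  (forall x, A x -> (F x < +oo)%E) /\
  (forall (t : R) (x y : E), 0 <= t <= 1 -> A x -> A y ->
    (t%:E * F x + (1 - t)%:E * F y <= F (t *: x + (1 - t) *: y)%R)%E).

Section t_entropy.
Context {d : measure_display} {X : measurableType d} {R : realType}.
Variables (m : {measure set X -> \bar R}) (alpha : X -> X).

Lemma finite_norm_cst1 : finite_norm m +oo%E (cst 1 : X -> R).
Proof.
rewrite /finite_norm unlock /Lnorm; case: ifPn => // m0.
have -> : abse \o (EFin \o (cst 1 : X -> R)) = cst 1%E.
  by apply/boolp.funext => x /=; rewrite normr1.
by rewrite ess_sup_inf.ess_sup_cst// ltry.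
Qed.

Lemma cst1_Lfun : (cst 1 : X -> R) \in Lfun m +oo%E.
Proof.
rewrite inE; apply/andP; split; rewrite !inE//=.
exact: finite_norm_cst1.
Qed.

Definition Linf_one : Linfun m := Lfun_Sub (leey 1%E) cst1_Lfun.

(* Boundedness on L^1 of f |-> f \o alpha.  The inequality applied to f - g
   also makes the operator well defined on a.e.-classes. *)
Definition shift_bounded : Prop :=
  exists C : R, forall f : L1fun m,
    ('N[m]_1[EFin \o (f \o alpha)] <= C%:E * 'N[m]_1[EFin \o f])%E.

(* The set M(X, m).  Positivity is required for a.e.-nonnegative f, so mu f
   depends only on the a.e.-class of f; hence these are exactly the positive
   normalized linear functionals on the space of a.e.-classes. *)
Definition pos_normalized : set (Linfun m -> R^o) :=
  [set mu : Linfun m -> R^o | [/\ linear mu,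
    forall f : Linfun m, {ae m, forall x, 0 <= f x} -> 0 <= (mu f : R)
    & mu Linf_one = 1]].

(* A partition is a list, so a function may be repeated in it. *)
Definition partition_of_unity (D : seq (Linfun m)) : Prop :=
  (forall g, g \in D -> {ae m, forall x, 0 <= g x}) /\
  {ae m, forall x, \sum_(g <- D) g x = 1}.

Local Open Scope ereal_scope.

(* With lne 0 = -oo the case int g dm = 0, mu g > 0 needs no separate clause. *)
Definition tau_term (n : nat) (mu : Linfun m -> R^o) (f : L1fun m)
    (g : Linfun m) : \bar R :=
  if mu g == 0%R then 0
  else (mu g)%:E *
       lne ((\int[m]_x (g x * `|f (iter n alpha x)|)%:E) * ((mu g)^-1)%:E).

Definition tau_partition (n : nat) (D : seq (Linfun m))
    (mu : Linfun m -> R^o) : \bar R :=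
  ereal_sup [set \sum_(g <- D) tau_term n mu f g |
             f in [set f : L1fun m | 'N[m]_1[EFin \o f] = 1]].

Definition tau_n (n : nat) (mu : Linfun m -> R^o) : \bar R :=
  ereal_inf [set tau_partition n D mu | D in partition_of_unity].

Definition t_entropy (mu : Linfun m -> R^o) : \bar R :=
  ereal_inf [set (n%:R^-1)%:E * tau_n n mu | n in [set n | (0 < n)%N]].

End t_entropy.

Arguments pos_normalized {d X R} m _.

(* Main.v *)
Require Import Defs.
From HB Require Import structures.
From mathcomp Require Import all_boot all_order all_algebra.
From mathcomp Require Import all_classical all_reals all_analysis.
From mathcomp Require Import measurable_realfun ess_sup_inf ring lra.

(** For a fixed weight g, the summand mu(g) ln (a / mu(g)) is a function of the
    pair (mu(g), a), where a is the integral of g |f o alpha^n|.  That function,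
    entropy_term, is the perspective of the concave function ln, hence jointly
    concave ([concave_entropy_term]): it is positively homogeneous
    ([entropy_termZ]) and superadditive ([entropy_termD], the log-sum
    inequality).

    Both entries of the pair behave affinely.  The value of t mu + (1 - t) nu
    at g is the combination of the values.  If f1 and f2 have norm 1, then so
    does f = t |f1| + (1 - t) |f2|, because the L^1 norm is additive on
    nonnegative functions, and the integral of g |f o alpha^n| is the
    combination of the integrals for f1 and f2.  So f does for t mu + (1 - t) nu
    at least as well as f1 does for mu and f2 for nu together, and the supremum
    over f is concave ([concave_on_sup], [concave_tau_partition]).

    The t-entropy comes from these functions by infima and by the positive
    factors 1 / n, and both operations preserve concavity.

    Concavity of an extended-real function is meaningful only if +oo is
    excluded.  Boundedness of the shift on L^1 and essential boundedness of g
    bound the integral of g |f o alpha^n| uniformly over the unit sphere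
    ([weighted_integral_bounded]), and entropy_term is monotone in its second
    argument; this makes tau_n(mu, D) < +oo ([tau_partition_lty]).  An infimum
    stays below +oo as soon as it runs over at least one index, which the
    one-element partition provides. *)

Set Implicit Arguments.
Unset Strict Implicit.
Unset Printing Implicit Defensive.

Import Order.TTheory GRing.Theory Num.Theory.
Import numFieldNormedType.Exports.

Local Open Scope classical_set_scope.
Local Open Scope ring_scope.

(** * The perspective of the logarithm *)

Section entropy_term.
Context {R : realType}.
Implicit Types (p q r s : R) (a b : \bar R).
Local Open Scope ereal_scope.

(** The perspective of ln; the value 0 at p = 0 is its convention for null
    weights.  As lne is -oo on ]-oo, 0], the value at a = 0 < p is -oo. *)
Definition entropy_term p a : \bar R :=
  if p == 0%R then 0 else p%:E * lne (a * p^-1%:E).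

Lemma entropy_term0 a : entropy_term 0 a = 0.
Proof. by rewrite /entropy_term eqxx. Qed.

Lemma entropy_term_EFin p r : (0 < p)%R -> (0 < r)%R ->
  entropy_term p r%:E = (p * (ln r - ln p))%:E.
Proof.
move=> p0 r0; rewrite /entropy_term gt_eqF// -EFinM lne_EFin ?divr_gt0//.
by rewrite -EFinM ln_div// posrE.
Qed.

Lemma entropy_term_0r p : (0 < p)%R -> entropy_term p 0 = -oo.
Proof.
by move=> p0; rewrite /entropy_term gt_eqF// mul0e le0_lneNy// gt0_muleNy.
Qed.

Lemma entropy_term_lty p r : (0 <= p)%R -> entropy_term p r%:E < +oo.
Proof.
rewrite le_eqVlt => /predU1P[<-|p0]; first by rewrite entropy_term0.
rewrite /entropy_term gt_eqF// -EFinM.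
have [r0|r0] := leP (r / p)%R 0%R.
  by rewrite le0_lneNy ?lee_fin// gt0_muleNy.
by rewrite lne_EFin// -EFinM ltry.
Qed.

Lemma le_entropy_term p a b : (0 <= p)%R -> 0 <= a -> a <= b ->
  entropy_term p a <= entropy_term p b.
Proof.
move=> p0 a0 ab; rewrite /entropy_term; case: ifPn => // pn0.
have p1 : (0 <= p^-1)%R by rewrite invr_ge0.
rewrite lee_wpmul2l ?lee_fin// lee_lne ?in_itv/= ?leey ?andbT ?mule_ge0 ?lee_fin//.
  by rewrite lee_wpmul2r ?lee_fin.
by rewrite (le_trans a0).
Qed.

Lemma entropy_termZ s p a : (0 < s)%R ->
  entropy_term (s * p) (s%:E * a) = s%:E * entropy_term p a.
Proof.
move=> s0; rewrite /entropy_term mulf_eq0 (gt_eqF s0)/=.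
case: ifPn => [_|p0]; first by rewrite mule0.
rewrite EFinM -muleA; congr (_ * (_ * lne _)).
by rewrite invfM EFinM muleACA -EFinM mulfV ?gt_eqF// mul1e.
Qed.

(** The log-sum inequality.  When all four numbers are positive, it is the sum
    of two tangent inequalities for ln at the common ratio (r + s) / (p + q):
    their right-hand sides cancel. *)
Lemma entropy_termD p q r s :
  (0 <= p)%R -> (0 <= q)%R -> (0 <= r)%R -> (0 <= s)%R ->
  entropy_term p r%:E + entropy_term q s%:E <=
  entropy_term (p + q) (r + s)%:E.
Proof.
move=> p0 q0 r0 s0.
move: p0; rewrite le_eqVlt => /predU1P[<-|p0].
  rewrite entropy_term0 add0e add0r; apply: le_entropy_term => //.
  by rewrite lee_fin lerDr.
move: q0; rewrite le_eqVlt => /predU1P[<-|q0].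
  rewrite entropy_term0 adde0 addr0; apply: le_entropy_term => //.
    exact: ltW.
  by rewrite lee_fin lerDl.
move: r0; rewrite le_eqVlt => /predU1P[<-|r0].
  by rewrite entropy_term_0r// addNye leNye.
move: s0; rewrite le_eqVlt => /predU1P[<-|s0].
  by rewrite addeC entropy_term_0r// addNye leNye.
have rs0 : (0 < r + s)%R by rewrite addr_gt0.
have pq0 : (0 < p + q)%R by rewrite addr_gt0.
rewrite !entropy_term_EFin// -EFinD lee_fin.
(* This is u * ln w <= u * (w - 1), with w the quotient of v / u by the
   common ratio. *)
have tangent (u v : R) : (0 < u)%R -> (0 < v)%R ->
    (u * (ln v - ln u - ln (r + s) + ln (p + q)) <=
     v * (p + q) / (r + s) - u)%R.
  move=> u0 v0; set w := (v * (p + q) / (u * (r + s)))%R.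
  have w0 : (0 < w)%R by rewrite divr_gt0// mulr_gt0.
  have -> : (ln v - ln u - ln (r + s) + ln (p + q))%R = ln w.
    by rewrite /w ln_div ?posrE ?mulr_gt0// !lnM ?posrE//; ring.
  have -> : (v * (p + q) / (r + s) - u = u * (w - 1))%R.
    by rewrite /w; field; rewrite !gt_eqF.
  rewrite ler_pM2l//.
  by have := @le_ln1Dx _ (w - 1); rewrite subrKC; apply; lra.
have := lerD (tangent p r p0 r0) (tangent q s q0 s0).
have -> : (r * (p + q) / (r + s) - p + (s * (p + q) / (r + s) - q) = 0)%R.
  by field; rewrite gt_eqF.
by lra.
Qed.

Lemma concave_entropy_term s p q a b : (0 < s < 1)%R ->
  (0 <= p)%R -> (0 <= q)%R -> 0 <= a -> a < +oo -> 0 <= b -> b < +oo ->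
  s%:E * entropy_term p a + (1 - s)%:E * entropy_term q b <=
  entropy_term (s * p + (1 - s) * q) (s%:E * a + (1 - s)%:E * b).
Proof.
move=> /andP[s0 s1] p0 q0; case: a => // a; case: b => // b.
rewrite !lee_fin => a0 _ b0 _.
rewrite -!entropy_termZ ?subr_gt0// -!EFinM -EFinD.
by apply: entropy_termD; rewrite mulr_ge0// ?subr_ge0 ltW.
Qed.

End entropy_term.

(** * Suprema, infima and multiples of concave functions *)

Section concave_on.
Context {R : realType} {E : lmodType R}.
Implicit Types (A : set E).
Local Open Scope ereal_scope.

(** A supremum of functions need not be concave.  It is if the index can be
    adapted: near-optimal indices at x and at y yield an index that does at
    least as well at the convex combination. *)
Lemma concave_on_sup A (I : Type) (P : set I) (F : I -> E -> \bar R) :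
  (forall x, A x -> ereal_sup [set F i x | i in P] < +oo) ->
  (forall (t : R) x y i j, (0 < t < 1)%R -> A x -> A y -> P i -> P j ->
    exists2 k, P k &
      t%:E * F i x + (1 - t)%:E * F j y <= F k (t *: x + (1 - t) *: y)%R) ->
  concave_on A (fun x => ereal_sup [set F i x | i in P]).
Proof.
move=> Fy Fc; split=> // t x y /andP[t0 t1] Ax Ay.
move: t0; rewrite le_eqVlt => /predU1P[<-|t0].
  by rewrite mul0e add0e scale0r add0r subr0 mul1e scale1r.
move: t1; rewrite le_eqVlt => /predU1P[->|t1].
  by rewrite subrr mul0e adde0 scale0r addr0 mul1e scale1r.
have u0 : (0 < 1 - t)%R by rewrite subr_gt0.
set S := ereal_sup _; set S' := ereal_sup [set F i y | i in P].
have SP z e : ereal_sup [set F i z | i in P] \is a fin_num -> (0 < e)%R ->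
    exists2 i, P i & ereal_sup [set F i z | i in P] - e%:E <= F i z.
  move=> Sf e0; have [_ [i Pi <-] /ltW iS] := ub_ereal_sup_adherent e0 Sf.
  by exists i.
(* If a supremum is -oo, so is the left-hand side, since t and 1 - t are
   positive here. *)
have [->|SNy] := eqVneq S -oo; first by rewrite gt0_muleNy// addNye leNye.
have [->|S'Ny] := eqVneq S' -oo; first by rewrite addeC gt0_muleNy// addNye leNye.
have Sf : S \is a fin_num by rewrite fin_numE SNy -ltey Fy.
have S'f : S' \is a fin_num by rewrite fin_numE S'Ny -ltey Fy.
apply/lee_addgt0Pr => e e0.
have [i Pi iS] := SP _ _ Sf e0.
have [j Pj jS] := SP _ _ S'f e0.
have [k Pk ijk] := Fc t x y i j (introT andP (conj t0 t1)) Ax Ay Pi Pj.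
have kS : F k (t *: x + (1 - t) *: y)%R <=
    ereal_sup [set F i (t *: x + (1 - t) *: y)%R | i in P].
  by apply: ereal_sup_ubound; exists k.
rewrite -leeBlDr//; apply: le_trans (le_trans ijk kS).
have -> : t%:E * S + (1 - t)%:E * S' - e%:E =
    t%:E * (S - e%:E) + (1 - t)%:E * (S' - e%:E).
  by rewrite -(fineK Sf) -(fineK S'f) -!(EFinM, EFinB, EFinD); congr EFin; ring.
by apply: leeD; apply: lee_wpmul2l => //; rewrite lee_fin ltW.
Qed.

Lemma concave_on_inf A (I : Type) (P : set I) (F : I -> E -> \bar R) :
  P !=set0 -> (forall i, P i -> concave_on A (F i)) ->
  concave_on A (fun x => ereal_inf [set F i x | i in P]).
Proof.
move=> [i0 Pi0] Fc; split=> [x Ax|t x y /andP[t0 t1] Ax Ay].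
  apply: le_lt_trans ((Fc _ Pi0).1 _ Ax).
  by apply: ereal_inf_lbound; exists i0.
apply: le_ereal_inf_tmp => _ [i Pi <-].
apply: le_trans ((Fc _ Pi).2 t x y _ Ax Ay); last by rewrite t0.
by apply: leeD; apply: lee_wpmul2l; rewrite ?lee_fin ?subr_ge0//;
  apply: ereal_inf_lbound; exists i.
Qed.

Lemma concave_onZ A (r : R) (F : E -> \bar R) : (0 <= r)%R ->
  concave_on A F -> concave_on A (fun x => r%:E * F x).
Proof.
move=> r0 [Fy Fc]; split=> [x Ax|t x y t01 Ax Ay].
  exact: lte_mul_pinfty (Fy _ Ax).
apply: le_trans (lee_wpmul2l _ (Fc t x y t01 Ax Ay)); last by rewrite lee_fin.
have /andP[t0 t1] := t01.
have ltyZ (s : R) z : (0 <= s)%R -> A z -> s%:E * F z < +oo.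
  by move=> s0 Az; apply: lte_mul_pinfty => //; exact: Fy.
rewrite muleDr//; last first.
  by rewrite /adde_def !negb_and !(lt_eqF (ltyZ _ _ _ _)) ?orbT ?subr_ge0.
by rewrite muleCA [X in _ + X <= _]muleCA.
Qed.

End concave_on.

(** * Functions in the spaces of bounded and of integrable functions *)

Section integrals.
Context {d : measure_display} {X : measurableType d} {R : realType}.
Variable m : {measure set X -> \bar R}.
Local Open Scope ereal_scope.

(** The case m = 0 is separate because the L^oo norm is then 0 by definition
    and does not bound g; but every property then holds almost everywhere. *)
Lemma Linf_ae_bounded (g : Linfun m) :
  exists2 M : R, (0 <= M)%R & {ae m, forall x, (`|g x| <= M)%R}.
Proof.
have := Lfunction_finite _ g; rewrite /finite_norm unlock /Lnorm.
case: ifPn => [m0 /ess_supr_bounded[M gM]|].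
  exists `|M|%R => //; apply: filterS gM => x /le_trans; apply.
  exact: ler_norm.
rewrite -leNgt => m0 _; exists 0%R => //.
exists setT; split=> //.
by apply/eqP; rewrite -measure_le0.
Qed.

(** Absolute values make the norm additive: for f1 and f2 themselves only the
    triangle inequality would hold. *)
Lemma Lnorm_convex_abs (f1 f2 : L1fun m) (s t : R) :
  (0 <= s)%R -> (0 <= t)%R ->
  exists f : L1fun m, f =1 (fun x => s * `|f1 x| + t * `|f2 x|)%R /\
    'N[m]_1[EFin \o f] =
    s%:E * 'N[m]_1[EFin \o f1] + t%:E * 'N[m]_1[EFin \o f2].
Proof.
move=> s0 t0.
pose h := (s *: (Num.norm \o f1) + t *: (Num.norm \o f2))%R.
have hL : h \in Lfun m 1%:E.
  rewrite /h rpredD// rpredZ//; apply: Lfun_norm; exact: LfunP.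
exists (Lfun_Sub (@lexx _ _ 1%E) hL); split=> //.
rewrite !Lnorm1 /=.
have mf (f : L1fun m) (r : R) : measurable_fun setT (fun x => r%:E * `|(f x)%:E|).
  by apply: measurable_funeM; do 2 apply: measurableT_comp => //.
rewrite -!ge0_integralZl_EFin//; last 2 first.
  by do 2 apply: measurableT_comp => //.
  by do 2 apply: measurableT_comp => //.
rewrite -ge0_integralD//.
- apply: eq_integral => x _; congr EFin; apply: ger0_norm.
  by apply: addr_ge0; apply: mulr_ge0 => //=.
- by move=> x _; exact: mule_ge0.
- exact: mf.
- by move=> x _; exact: mule_ge0.
- exact: mf.
Qed.

End integrals.

(** * Integrals along the shift *)

Section shift.
Context {d : measure_display} {X : measurableType d} {R : realType}.
Variables (m : {measure set X -> \bar R}) (alpha : X -> X).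
Hypotheses (malpha : measurable_fun setT alpha)
  (bounded_alpha : shift_bounded m alpha).
Local Open Scope ereal_scope.

Lemma measurable_iter n : measurable_fun setT (iter n alpha).
Proof.
elim: n => [|n ih]; first exact: measurable_id.
by rewrite (_ : iter _ _ = alpha \o iter n alpha)//; exact: measurableT_comp.
Qed.

Lemma Lnorm_shift_iter_bounded n : exists2 C : R, (0 <= C)%R &
  forall f : L1fun m,
    'N[m]_1[EFin \o (f \o iter n alpha)] <= C%:E * 'N[m]_1[EFin \o f].
Proof.
have [C0 HC0] := bounded_alpha.
(* The bound given by boundedness may be negative if all norms vanish. *)
pose C := Num.max C0 0%R.
have C_ge0 : (0 <= C)%R by rewrite le_max lexx orbT.
have HC (f : L1fun m) :
    'N[m]_1[EFin \o (f \o alpha)] <= C%:E * 'N[m]_1[EFin \o f].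
  apply: le_trans (HC0 f) _; apply: lee_wpmul2r; first exact: Lnorm_ge0.
  by rewrite lee_fin le_max lexx.
exists (C ^+ n)%R; first exact: exprn_ge0.
elim: n => [|n ih] f; first by rewrite mul1e.
have fn : (f \o iter n alpha) \in Lfun m 1%:E.
  rewrite inE; apply/andP; split; rewrite inE/=.
    by apply: measurableT_comp => //; exact: measurable_iter.
  apply: le_lt_trans (ih f) _; apply: lte_mul_pinfty => //.
    by rewrite lee_fin exprn_ge0.
  exact: Lfunction_finite.
have := HC (Lfun_Sub (@lexx _ _ 1%E) fn).
have -> : f \o iter n.+1 alpha = (f \o iter n alpha) \o alpha.
  by apply/funext => x; rewrite /= -iterSr.
move=> /= /le_trans; apply; rewrite exprS EFinM -muleA.
by apply: lee_wpmul2l => //; exact: ih.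
Qed.

Definition weighted_integral n (f : L1fun m) (g : Linfun m) : \bar R :=
  \int[m]_x (g x * `|f (iter n alpha x)|)%:E.

Section nonneg_weight.
Variables (n : nat) (g : Linfun m).
Hypothesis g0 : {ae m, forall x, (0 <= g x)%R}.

Let measurable_weighted (f : L1fun m) (g' : X -> R) : measurable_fun setT g' ->
  measurable_fun setT (fun x => (g' x * `|f (iter n alpha x)|)%:E).
Proof.
move=> mg; apply/measurable_EFinP/measurable_funM => //.
do 2 apply: measurableT_comp => //; exact: measurable_iter.
Qed.

Let measurable_normg : measurable_fun setT (fun x => `|g x|%R).
Proof. exact: measurableT_comp. Qed.

(** Replaces the weight by one that is nonnegative everywhere, as the integral
    calculus for nonnegative functions requires. *)
Lemma weighted_integralE (f : L1fun m) : weighted_integral n f g =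
  \int[m]_x (`|g x| * `|f (iter n alpha x)|)%:E.
Proof.
apply: ae_eq_integral => //; [exact: measurable_weighted.. |].
by apply: filterS g0 => x gx0 _ /=; rewrite (ger0_norm gx0).
Qed.

Lemma weighted_integral_ge0 (f : L1fun m) : 0 <= weighted_integral n f g.
Proof.
by rewrite weighted_integralE integral_ge0// => x _; rewrite lee_fin mulr_ge0.
Qed.

Lemma weighted_integral_bounded : exists K : R, forall f : L1fun m,
  'N[m]_1[EFin \o f] = 1 -> weighted_integral n f g <= K%:E.
Proof.
have [M M0 gM] := Linf_ae_bounded g.
have [C C0 HC] := Lnorm_shift_iter_bounded n.
exists (M * C)%R => f f1; rewrite weighted_integralE EFinM.
have mfn : measurable_fun setT (fun x => `|(f (iter n alpha x))%:E|).
  by do 3 apply: measurableT_comp => //; exact: measurable_iter.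
apply: (@le_trans _ _ (M%:E * 'N[m]_1[EFin \o (f \o iter n alpha)])).
  rewrite Lnorm1 -ge0_integralZl_EFin//.
  apply: ae_ge0_le_integral => //.
  - exact: measurable_weighted.
  - by move=> x _; apply: mule_ge0.
  - exact: measurable_funeM.
  - by apply: filterS gM => x gx _; rewrite /= -EFinM lee_fin ler_wpM2r.
by apply: lee_wpmul2l => //; have := HC f; rewrite f1 mule1.
Qed.

Lemma weighted_integral_convex_abs (s t : R) (f f1 f2 : L1fun m) :
  (0 <= s)%R -> (0 <= t)%R ->
  f =1 (fun x => s * `|f1 x| + t * `|f2 x|)%R ->
  weighted_integral n f g =
  s%:E * weighted_integral n f1 g + t%:E * weighted_integral n f2 g.
Proof.
move=> s0 t0 fE; rewrite !weighted_integralE.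
have pos (f' : L1fun m) x : 0 <= (`|g x| * `|f' (iter n alpha x)|)%:E.
  by rewrite lee_fin mulr_ge0.
rewrite -!ge0_integralZl_EFin//; [|exact: measurable_weighted..].
rewrite -ge0_integralD//.
- apply: eq_integral => x _; rewrite fE -!EFinM -EFinD; congr EFin.
  by rewrite [`|_ + _|%R]ger0_norm ?addr_ge0// ?mulr_ge0//; ring.
- by move=> x _; exact: mule_ge0.
- by apply: measurable_funeM; exact: measurable_weighted.
- by move=> x _; exact: mule_ge0.
- by apply: measurable_funeM; exact: measurable_weighted.
Qed.

End nonneg_weight.

(** * Concavity of the t-entropy *)

Lemma tau_termE n mu (f : L1fun m) (g : Linfun m) :
  tau_term alpha n mu f g = entropy_term (mu g) (weighted_integral n f g).
Proof. by []. Qed.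

Lemma partition_of_unity1 : partition_of_unity [:: Linf_one m].
Proof.
split=> [g|]; first by rewrite inE => /eqP ->; apply: nearW => x /=.
by apply: nearW => x; rewrite big_seq1.
Qed.

Lemma tau_partition_lty n (D : seq (Linfun m)) (mu : Linfun m -> R^o) :
  (forall g, g \in D -> {ae m, forall x, (0 <= g x)%R}) ->
  pos_normalized m mu -> tau_partition alpha n D mu < +oo.
Proof.
move=> D0 [_ mu0 _].
(* xget picks, for each g, a bound of the weighted integrals over the unit
   sphere. *)
pose K (g : Linfun m) : R := xget 0%R [set K | forall f : L1fun m,
  'N[m]_1[EFin \o f] = 1 -> weighted_integral n f g <= K%:E].
apply: (@le_lt_trans _ _ (\sum_(g <- D | g \in D) entropy_term (mu g) (K g)%:E)).
  apply: ge_ereal_sup => _ [f /= f1 <-]; rewrite big_seq.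
  apply: lee_sum => g gD; rewrite tau_termE.
  apply: le_entropy_term; first by apply: mu0; exact: D0.
    by apply: weighted_integral_ge0; exact: D0.
  rewrite /K; case: xgetP => [K' _|noK]; first exact.
  by have [K' /noK] := weighted_integral_bounded n (D0 _ gD).
apply: lte_sum_pinfty => g gD; apply: entropy_term_lty.
by apply: mu0; exact: D0.
Qed.

(** Any competitors f1 for mu and f2 for nu are combined into
    t |f1| + (1 - t) |f2|; the inequality then holds summand by summand. *)
Lemma concave_tau_partition n (D : seq (Linfun m)) :
  (forall g, g \in D -> {ae m, forall x, (0 <= g x)%R}) ->
  concave_on (pos_normalized m) (tau_partition alpha n D).
Proof.
move=> D0; apply: (@concave_on_sup _ _ _ _ _
  (fun f mu => \sum_(g <- D) tau_term alpha n mu f g)) => [mu Mmu|].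
  exact: tau_partition_lty.
move=> t mu nu f1 f2 /andP[t0 t1] Mmu Mnu /= Nf1 Nf2.
have [[_ mu0 _] [_ nu0 _]] := (Mmu, Mnu).
have u0 : (0 < 1 - t)%R by rewrite subr_gt0.
have [f [fE Nf]] := Lnorm_convex_abs f1 f2 (ltW t0) (ltW u0).
exists f; first by rewrite Nf Nf1 Nf2 !mule1 -EFinD subrKC.
have int_lty g (h : L1fun m) : g \in D -> 'N[m]_1[EFin \o h] = 1 ->
    weighted_integral n h g < +oo.
  move=> gD Nh; have [K HK] := weighted_integral_bounded n (D0 _ gD).
  exact: le_lt_trans (HK _ Nh) (ltry _).
have term_lty g (h : L1fun m) mu' : g \in D -> pos_normalized m mu' ->
    'N[m]_1[EFin \o h] = 1 -> tau_term alpha n mu' h g < +oo.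
  move=> gD [_ mu'0 _] Nh; rewrite tau_termE.
  have := int_lty _ _ gD Nh; have := weighted_integral_ge0 n (D0 _ gD) h.
  case: (weighted_integral n h g) => // r _ _.
  by apply: entropy_term_lty; apply: mu'0; exact: D0.
(* Extended-real addition distributes only when +oo and -oo do not meet. *)
have sumZ (s : R) mu' (h : L1fun m) : (0 < s)%R -> pos_normalized m mu' ->
    'N[m]_1[EFin \o h] = 1 ->
    s%:E * (\sum_(g <- D) tau_term alpha n mu' h g) =
    \sum_(g <- D | g \in D) s%:E * tau_term alpha n mu' h g.
  move=> s0 Mmu' Nh; rewrite big_seq fin_num_sume_distrr// => g h' gD h'D.
  by apply: ltpinfty_adde_def; rewrite inE; exact: term_lty.
rewrite !sumZ// -big_split/= [leRHS]big_seq.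
apply: lee_sum => g gD; rewrite !tau_termE.
rewrite (weighted_integral_convex_abs _ (D0 _ gD) (ltW t0) (ltW u0) fE).
apply: concave_entropy_term; rewrite ?t0//.
- by apply: mu0; exact: D0.
- by apply: nu0; exact: D0.
- exact: weighted_integral_ge0 (D0 _ gD) _.
- exact: int_lty.
- exact: weighted_integral_ge0 (D0 _ gD) _.
- exact: int_lty.
Qed.

Lemma concave_t_entropy : concave_on (pos_normalized m) (t_entropy alpha).
Proof.
apply: concave_on_inf => [|n _]; first by exists 1%N.
apply: concave_onZ; first by rewrite invr_ge0.
apply: concave_on_inf => [|D [D0 _]]; last exact: concave_tau_partition.
by exists [:: Linf_one m]; exact: partition_of_unity1.
Qed.
End shift.

Theorem proposition5 (d : measure_display) (X : measurableType d)
    (R : realType) (m : {sigma_finite_measure set X -> \bar R})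
    (alpha : X -> X) (malpha : measurable_fun setT alpha)
    (bounded_alpha : shift_bounded m alpha) :
  (forall (n : nat) (D : seq (Linfun m)), (0 < n)%N ->
     partition_of_unity D ->
     concave_on (pos_normalized m) (tau_partition alpha n D)) /\
  concave_on (pos_normalized m) (t_entropy alpha).
Proof.
split; first by move=> n D _ [D0 _]; exact: concave_tau_partition.
exact: concave_t_entropy.
Qed.
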